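(* Let $\Theta\in\mathbb{R}^{p\times p}$, $\Psi\in\mathbb{R}^{q\times q}$ be symmetric with $\Theta\oplus\Psi\succ0$, and let $(D_\Theta,D_\Psi)$ be a pair of symmetric matrices solving $$\min_{\Delta_\Theta,\Delta_\Psi}\ \hat g(\Delta_\Theta,\Delta_\Psi)+h(\Theta+\Delta_\Theta,\Psi+\Delta_\Psi).$$ Within the equivalence class $\{(D_\Theta-cI_p,\,D_\Psi+cI_q): c\in\mathbb{R}\}$ the line-search method identifies a unique step size $\alpha$; that is, running the line search from $(\Theta,\Psi)$ with any member of this class as the descent direction yields the same step size $\alpha$.
   Context: $p,q,n\ge1$ are integers. $I_a$ is the $a\times a$ identity, $\otimes$ the Kronecker product, $\Theta\oplus\Psi=\Theta\otimes I_q+I_p\otimes\Psi$, $\operatorname{vec}$ stacks columns, $e_{a,i}$ is the $i$th standard basis vector of $\mathbb{R}^a$, and $\|A\|_{1,\mathrm{off}}=\sum_{i\ne j}|A_{ij}|$. Given data $Y^1,\dots,Y^n\in\mathbb{R}^{q\times p}$ and regularization parameters $\gamma_\Theta,\gamma_\Psi\geq 0$, set $S=\frac1{nq}\sum_iY^{iT}Y^i$, $T=\frac1{np}\sum_iY^iY^{iT}$, $g(\Theta,\Psi)=q\operatorname{tr}(S\Theta)+p\operatorname{tr}(T\Psi)-\log|\Theta\oplus\Psi|$, $h(\Theta,\Psi)=q\gamma_\Theta\|\Theta\|_{1,\mathrm{off}}+p\gamma_\Psi\|\Psi\|_{1,\mathrm{off}}$, $f=g+h$. With $W=(\Theta\oplus\Psi)^{-1}$,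 the gradient of $g$ has blocks $G_\Theta=qS-\sum_{i=1}^q(I_p\otimes e_{q,i})^TW(I_p\otimes e_{q,i})$, $G_\Psi=pT-\sum_{j=1}^p(e_{p,j}\otimes I_q)^TW(e_{p,j}\otimes I_q)$, and $\operatorname{vec}(G)=[\operatorname{vec}(G_\Theta)^T,\operatorname{vec}(G_\Psi)^T]^T$. The Hessian is $H=P^T(W\otimes W)P$ with $P=[\sum_{i=1}^qI_p\otimes e_{q,i}\otimes I_p\otimes e_{q,i},\ \sum_{j=1}^pe_{p,j}\otimes I_q\otimes e_{p,j}\otimes I_q]$, and $\hat g(\Delta_\Theta,\Delta_\Psi)=\operatorname{vec}(G)^Tv+\frac12v^THv$ where $v=[\operatorname{vec}(\Delta_\Theta)^T,\operatorname{vec}(\Delta_\Psi)^T]^T$. Line search: fix $0<\sigma<0.5$ and $0<\beta<1$. Given $(\Theta,\Psi)$ and a direction $(D_\Theta,D_\Psi)$ with $\operatorname{vec}(D)=[\operatorname{vec}(D_\Theta)^T,\operatorname{vec}(D_\Psi)^T]^T$, start from $\alpha=1$ and repeatedly replace $\alpha$ by $\alpha\beta$ until both conditions hold: (1) $(\Theta+\alpha D_\Theta)\oplus(\Psi+\alpha D_\Psi)\succ0$; (2) $f(\Theta+\alpha D_\Theta,\Psi+\alpha D_\Psi)\le f(\Theta,\Psi)+\alpha\sigma\delta$, where $\delta=\operatorname{vec}(D)^T\operatorname{vec}(G)+h(\Theta+D_\Theta,\Psi+D_\Psi)-h(\Theta,\Psi)$. The returned step size is the first such $\alpha$. *)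

(* Defs.v *)
From HB Require Import structures.
From mathcomp Require Import all_boot all_order all_algebra.
From mathcomp Require Import mxtens.
From mathcomp Require Import reals exp.
Set Implicit Arguments.
Unset Strict Implicit.
Unset Printing Implicit Defensive.
Import Order.TTheory GRing.Theory Num.Theory.
Local Open Scope ring_scope.

(* [A *t B] is the Kronecker product: row (i, k) of A *t B sits at position
   i * m + k, where m is the number of rows of B, and similarly for columns. *)

(* mxvec stacks rows, so the column-stacking vec goes through the transpose. *)
Definition vec (R : pzRingType) (m n : nat) (A : 'M[R]_(m, n)) : 'cV[R]_(n * m) :=
  (mxvec A^T)^T.

Definition symmx (R : pzRingType) (a : nat) (A : 'M[R]_a) : Prop := A^T = A.

Definition posdef (R : realType) (a : nat) (A : 'M[R]_a) : Prop :=
  symmx A /\ forall x : 'cV[R]_a, x != 0 -> 0 < (x^T *m A *m x) 0 0.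

Definition norm1off (R : realType) (a : nat) (A : 'M[R]_a) : R :=
  \sum_i \sum_(j | i != j) `|A i j|.

Definition kronsum (R : pzRingType) (p q : nat) (Theta : 'M[R]_p)
    (Psi : 'M[R]_q) : 'M[R]_(p * q) :=
  Theta *t (1%:M : 'M[R]_q) + (1%:M : 'M[R]_p) *t Psi.

(* I_p (x) e_{q,i} and e_{p,j} (x) I_q; the casts only identify the column
   counts p * 1 and 1 * q with p and q. *)
Definition IkronE (R : pzRingType) (p q : nat) (i : 'I_q) : 'M[R]_(p * q, p) :=
  castmx (erefl (p * q)%N, muln1 p)
    ((1%:M : 'M[R]_p) *t (delta_mx i 0 : 'cV[R]_q)).

Definition EkronI (R : pzRingType) (p q : nat) (j : 'I_p) : 'M[R]_(p * q, q) :=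
  castmx (erefl (p * q)%N, mul1n q)
    ((delta_mx j 0 : 'cV[R]_p) *t (1%:M : 'M[R]_q)).

Section Objective.
Context {R : realType} {p q n : nat}.
Variables (Y : 'I_n -> 'M[R]_(q, p)) (gT gP : R).

Definition covS : 'M[R]_p := (n * q)%:R^-1 *: \sum_i ((Y i)^T *m Y i).

Definition covT : 'M[R]_q := (n * p)%:R^-1 *: \sum_i (Y i *m (Y i)^T).

(* ln is 0 on nonpositive reals; g is only meaningful where
   kronsum Theta Psi is positive definite. *)
Definition objg (Theta : 'M[R]_p) (Psi : 'M[R]_q) : R :=
  q%:R * \tr (covS *m Theta) + p%:R * \tr (covT *m Psi)
  - ln (\det (kronsum Theta Psi)).

Definition objh (Theta : 'M[R]_p) (Psi : 'M[R]_q) : R :=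
  q%:R * gT * norm1off Theta + p%:R * gP * norm1off Psi.

Definition objf (Theta : 'M[R]_p) (Psi : 'M[R]_q) : R :=
  objg Theta Psi + objh Theta Psi.

Definition covW (Theta : 'M[R]_p) (Psi : 'M[R]_q) : 'M[R]_(p * q) :=
  invmx (kronsum Theta Psi).

Definition gradTheta (Theta : 'M[R]_p) (Psi : 'M[R]_q) : 'M[R]_p :=
  q%:R *: covS
  - \sum_(i < q) ((IkronE R p i)^T *m covW Theta Psi *m IkronE R p i).

Definition gradPsi (Theta : 'M[R]_p) (Psi : 'M[R]_q) : 'M[R]_q :=
  p%:R *: covT
  - \sum_(j < p) ((EkronI R q j)^T *m covW Theta Psi *m EkronI R q j).

Definition vec2 (A : 'M[R]_p) (B : 'M[R]_q) : 'cV[R]_(p * p + q * q) :=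
  col_mx (vec A) (vec B).

Definition vecG (Theta : 'M[R]_p) (Psi : 'M[R]_q) : 'cV[R]_(p * p + q * q) :=
  vec2 (gradTheta Theta Psi) (gradPsi Theta Psi).

(* Uses associativity of the Kronecker product to group the four factors of
   each summand two by two. *)
Definition matP : 'M[R]_(p * q * (p * q), p * p + q * q) :=
  row_mx (\sum_(i < q) IkronE R p i *t IkronE R p i)
         (\sum_(j < p) EkronI R q j *t EkronI R q j).

Definition hessian (Theta : 'M[R]_p) (Psi : 'M[R]_q)
    : 'M[R]_(p * p + q * q) :=
  matP^T *m (covW Theta Psi *t covW Theta Psi) *m matP.

Definition ghat (Theta : 'M[R]_p) (Psi : 'M[R]_q)
    (DT : 'M[R]_p) (DP : 'M[R]_q) : R :=
  let v := vec2 DT DP in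
  ((vecG Theta Psi)^T *m v) 0 0
  + 2^-1 * (v^T *m hessian Theta Psi *m v) 0 0.

Definition newton_model (Theta : 'M[R]_p) (Psi : 'M[R]_q)
    (DT : 'M[R]_p) (DP : 'M[R]_q) : R :=
  ghat Theta Psi DT DP + objh (Theta + DT) (Psi + DP).

(* The minimum is over pairs of symmetric matrices. *)
Definition newton_direction (Theta : 'M[R]_p) (Psi : 'M[R]_q)
    (DT : 'M[R]_p) (DP : 'M[R]_q) : Prop :=
  [/\ symmx DT, symmx DP
    & forall (ET : 'M[R]_p) (EP : 'M[R]_q), symmx ET -> symmx EP ->
        newton_model Theta Psi DT DP <= newton_model Theta Psi ET EP].

Definition decrement (Theta : 'M[R]_p) (Psi : 'M[R]_q)
    (DT : 'M[R]_p) (DP : 'M[R]_q) : R :=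
  ((vec2 DT DP)^T *m vecG Theta Psi) 0 0
  + objh (Theta + DT) (Psi + DP) - objh Theta Psi.

Definition step_ok (sigma : R) (Theta : 'M[R]_p) (Psi : 'M[R]_q)
    (DT : 'M[R]_p) (DP : 'M[R]_q) (alpha : R) : Prop :=
  posdef (kronsum (Theta + alpha *: DT) (Psi + alpha *: DP)) /\
  objf (Theta + alpha *: DT) (Psi + alpha *: DP)
    <= objf Theta Psi + alpha * sigma * decrement Theta Psi DT DP.

(* The search terminates and returns alpha: alpha is the first of
   1, beta, beta ^ 2, ... that is accepted. *)
Definition line_search (sigma beta : R) (Theta : 'M[R]_p) (Psi : 'M[R]_q)
    (DT : 'M[R]_p) (DP : 'M[R]_q) (alpha : R) : Prop :=
  exists k : nat,
    [/\ alpha = beta ^+ k,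
        step_ok sigma Theta Psi DT DP (beta ^+ k)
      & forall j : nat, (j < k)%N ->
          ~ step_ok sigma Theta Psi DT DP (beta ^+ j)].

End Objective.

(* Main.v *)
(* Shifting the direction by (- c I, c I) changes neither the Kronecker sum nor
   the off-diagonal norms, and trace S * q = trace T * p makes the linear part
   of g and the decrement insensitive to it too; so every member of the class
   passes exactly the same tests, and it remains to show that the search stops.

   Comparing the Newton direction with the zero direction in the model gives
   decrement <= - v^T H v / 2.  With a Cholesky factor Theta (+) Psi = L L^T and
   Z = L^-1 (DT (+) DP) L^-T, one has v^T H v = |Z|_F^2 and
   ln det(L (I + t Z) L^T) = ln det(L L^T) + ln det(I + t Z), where the last
   term is at least t tr Z - C t^2 for small t.  If Z != 0 the decrement is
   negative, hence small steps are accepted, h being convex.  If Z = 0 the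
   direction is equivalent to 0 and the unit step is accepted. *)
Require Import Defs.
From HB Require Import structures.
From mathcomp Require Import all_boot all_order all_algebra.
From mathcomp Require Import mxtens.
From mathcomp Require Import reals exp.
From mathcomp Require Import boolp sequences normedtype.
From mathcomp Require Import ring lra.
Set Implicit Arguments.
Unset Strict Implicit.
Unset Printing Implicit Defensive.
Import Order.TTheory GRing.Theory Num.Theory.
Import numFieldNormedType.Exports.
Local Open Scope ring_scope.

(** * Kronecker products, [vec] and the matrix P *)

Lemma index_allpairs (S T : eqType) (s : seq S) (t : seq T) (x : S) (y : T) :
  x \in s -> y \in t ->
  index (x, y) [seq (a, b) | a <- s, b <- t] = (index x s * size t + index y t)%N.
Proof.
move=> xs yt; elim: s xs => [//|a s IHs]; rewrite inE allpairs_cons index_cat /=.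
have inj_a : injective (pair a : T -> S * T) by move=> b c [].
case: (eqVneq x a) => [-> _|neq_xa /= xs].
  by rewrite mem_map // yt index_map.
rewrite ifN; last by apply/mapP => -[b _ [xa _]]; rewrite xa eqxx in neq_xa.
by rewrite size_map IHs // mulSn addnA.
Qed.

(** A product type is enumerated lexicographically, so the rank of a pair is [i * n + j], the
    position used by [*t]. This lets [vec] and Kronecker products share one indexing. *)
Lemma mxvec_tens_index (m n : nat) (i : 'I_m) (j : 'I_n) :
  mxvec_index i j = mxtens_index (i, j).
Proof.
apply: val_inj => /=; rewrite /enum_rank enum_rank_in.unlock insubdK; last first.
  by rewrite unfold_in /= cardE index_mem mem_enum.
rewrite enumT unlock /= index_allpairs ?mem_enum //.
by rewrite !index_enum_ord size_enum_ord.
Qed.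

Lemma vecE (R : pzRingType) (m n : nat) (A : 'M[R]_(m, n)) (i : 'I_m) (j : 'I_n) :
  vec A (mxtens_index (j, i)) 0 = A i j.
Proof. by rewrite mxE -mxvec_tens_index mxvecE mxE. Qed.

Lemma sum_mxtens (R : nmodType) (m n : nat) (F : 'I_(m * n) -> R) :
  \sum_k F k = \sum_i \sum_j F (mxtens_index (i, j)).
Proof.
rewrite pair_big /= (reindex (@mxtens_index m n)) /=; last first.
  by exists (@mxtens_unindex m n) => k _; rewrite (mxtens_indexK, mxtens_unindexK).
by apply: eq_bigr => -[].
Qed.

(** This identity turns the action of P and of the Kronecker square of W on a vectorised matrix into
    ordinary matrix products. *)
Lemma vec_tens (R : comPzRingType) (m n r s : nat) (A : 'M[R]_(m, n))
    (X : 'M[R]_(n, s)) (B : 'M[R]_(r, s)) :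
  (B *t A) *m vec X = vec (A *m X *m B^T).
Proof.
apply/matrixP => k l; rewrite ord1 {l}; case: (mxtens_indexP k) => j i.
rewrite vecE !mxE sum_mxtens; apply: eq_bigr => b _.
rewrite !mxE mulr_suml; apply: eq_bigr => a _.
by rewrite tensmxE vecE; ring.
Qed.

Lemma vec_trace (R : comPzRingType) (m n : nat) (A B : 'M[R]_(m, n)) :
  ((vec A)^T *m vec B) 0 0 = \tr (A^T *m B).
Proof.
rewrite mxE sum_mxtens; apply: eq_bigr => j _; rewrite mxE.
by apply: eq_bigr => i _; rewrite mxE !vecE mxE.
Qed.

Lemma IkronEE (R : pzRingType) (p q : nat) (i j : 'I_q) (a b : 'I_p) :
  IkronE R p i (mxtens_index (a, j)) b = ((a == b) && (j == i))%:R.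
Proof.
rewrite castmxE /= cast_ord_id.
have -> : cast_ord (esym (muln1 p)) b = mxtens_index (b, 0 : 'I_1).
  by apply: val_inj; rewrite /= muln1 addn0.
by rewrite tensmxE !mxE andbT -natrM mulnb.
Qed.

Lemma EkronIE (R : pzRingType) (p q : nat) (a j : 'I_p) (i b : 'I_q) :
  EkronI R q j (mxtens_index (a, i)) b = ((a == j) && (i == b))%:R.
Proof.
rewrite castmxE /= cast_ord_id.
have -> : cast_ord (esym (mul1n q)) b = mxtens_index (0 : 'I_1, b).
  by apply: val_inj; rewrite /= mul0n add0n.
by rewrite tensmxE !mxE andbT -natrM mulnb.
Qed.

(** At row (a, i) and column (b, j) only the summand of index [i] survives, and it vanishes unless i
    = j. The embeddings [IkronE] occur in both the gradient and P, so this lemma and its counterpart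
    for [EkronI] bring both back to Kronecker sums. *)
Lemma IkronE_sum (R : comPzRingType) (p q : nat) (A : 'M[R]_p) :
  \sum_(i < q) IkronE R p i *m A *m (IkronE R p i)^T = A *t 1%:M.
Proof.
apply/matrixP => k l.
case: (mxtens_indexP k) => a i; case: (mxtens_indexP l) => b j {k l}.
rewrite tensmxE summxE (bigD1 i) //= [X in _ + X]big1 ?addr0; last first.
  move=> k ki; rewrite mxE big1 // => c _; rewrite mxE.
  rewrite big1 ?mul0r // => d _.
  by rewrite IkronEE [i == k]eq_sym (negPf ki) andbF mul0r.
rewrite mxE (bigD1 b) //= big1 ?addr0; last first.
  by move=> c cb; rewrite !mxE IkronEE [b == c]eq_sym (negPf cb) mulr0.
rewrite [X in X * _]mxE (bigD1 a) //= big1 ?addr0; last first.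
  by move=> c ca; rewrite IkronEE [a == c]eq_sym (negPf ca) mul0r.
by rewrite !mxE !IkronEE !eqxx /= mul1r eq_sym.
Qed.

Lemma EkronI_sum (R : comPzRingType) (p q : nat) (A : 'M[R]_q) :
  \sum_(j < p) EkronI R q j *m A *m (EkronI R q j)^T = 1%:M *t A.
Proof.
apply/matrixP => k l.
case: (mxtens_indexP k) => a i; case: (mxtens_indexP l) => b j {k l}.
rewrite tensmxE summxE (bigD1 a) //= [X in _ + X]big1 ?addr0; last first.
  move=> k ki; rewrite mxE big1 // => c _; rewrite mxE.
  rewrite big1 ?mul0r // => d _.
  by rewrite EkronIE [a == k]eq_sym (negPf ki) mul0r.
rewrite mxE (bigD1 j) //= big1 ?addr0; last first.
  by move=> c cb; rewrite !mxE EkronIE [j == c]eq_sym (negPf cb) andbF mulr0.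
rewrite [X in X * _]mxE (bigD1 i) //= big1 ?addr0; last first.
  by move=> c ca; rewrite EkronIE [i == c]eq_sym (negPf ca) andbF mul0r.
by rewrite !mxE !EkronIE !eqxx /= mul1r andbT mulrC eq_sym.
Qed.

(** By [vec_tens], each summand E *t E of P sends [vec A] to the vectorisation of E A E^T, and these
    add up to a Kronecker sum. Hence the Hessian form sees a direction only through its Kronecker
    sum. *)
Lemma matP_vec2 (R : realType) (p q : nat) (A : 'M[R]_p) (B : 'M[R]_q) :
  matP *m vec2 A B = vec (kronsum A B).
Proof.
rewrite mul_row_col /kronsum -IkronE_sum -EkronI_sum.
rewrite 2!mulmx_suml.
under eq_bigr do rewrite vec_tens.
under [X in _ + X]eq_bigr do rewrite vec_tens.
have vecD m n : {morph (@vec R m n) : X Y / X + Y}.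
  by move=> X Y; rewrite /vec !linearD.
have vec0 m n : @vec R m n 0 = 0 by rewrite /vec !linear0.
by rewrite vecD !(big_morph _ (@vecD _ _) (@vec0 _ _)).
Qed.

(** * Cholesky factorisation *)

Lemma posdef_cholesky (R : realType) (m : nat) (M : 'M[R]_m) :
  posdef M -> exists2 L : 'M[R]_m, L \in unitmx & M = L *m L^T.
Proof.
elim: m M => [|m IHm] M [symM posM].
  by exists 1%:M; rewrite ?unitmx1 //; apply/matrixP => -[].
rewrite -[m.+1]/(1 + m)%N in M symM posM *.
set a := M 0 0; set b := dlsubmx M; set C := drsubmx M.
have MCE : M = block_mx a%:M b^T b C.
  rewrite -[LHS]submxK; congr block_mx.
    by rewrite [LHS]mx11_scalar !mxE; congr (M _ _)%:M; apply: val_inj.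
  by rewrite /b trmx_dlsub symM.
have a_gt0 : 0 < a.
  have nz : (col_mx 1%:M 0 : 'cV[R]_(1 + m)) != 0.
    by apply/eqP => /colP /(_ 0); rewrite !mxE; case: splitP => // j _;
      rewrite !mxE ord1 /= => /eqP; rewrite oner_eq0.
  have := posM _ nz; rewrite MCE tr_col_mx trmx1 trmx0 mul_row_block.
  rewrite !mul1mx !mul0mx !addr0 mul_row_col mulmx1 mulmx0 addr0.
  by rewrite mxE eqxx.
have symC : C^T = C by rewrite /C trmx_drsub symM.
(* The induction hypothesis is applied to the Schur complement of the corner entry [a]. *)
set S := C - a^-1 *: (b *m b^T).
have [L' uL' SE] : exists2 L : 'M[R]_m, L \in unitmx & S = L *m L^T.
  apply: IHm; split=> [|y y_neq0].
    by rewrite /symmx /S linearB linearZ /= trmx_mul trmxK symC.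
  (* With [y] fixed, this first coordinate minimises the quadratic form of [M], and the minimum is
     the form of [S] at [y]. *)
  pose x := col_mx (- (a^-1 *: (b^T *m y))) y : 'cV[R]_(1 + m).
  have x_neq0 : x != 0 by rewrite /x col_mx_eq0 negb_and y_neq0 orbT.
  suff -> : y^T *m S *m y = x^T *m M *m x by exact: posM.
  rewrite /x MCE tr_col_mx mul_row_block mul_row_col.
  have -> : (- (a^-1 *: (b^T *m y)))^T = - (a^-1 *: (y^T *m b)).
    by rewrite linearN linearZ /= trmx_mul trmxK.
  rewrite mul_mx_scalar.
  rewrite scalerN scalerA divff ?gt_eqF // scale1r addNr mul0mx add0r.
  rewrite /S mulmxBr mulmxBl mulmxDl addrC; congr (_ + _).
  by rewrite -scalemxAr -!scalemxAl !mulNmx -!scalemxAl !mulmxA.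
pose s := Num.sqrt a.
have s_gt0 : 0 < s by rewrite sqrtr_gt0.
have ss : s * s = a by rewrite -expr2 sqr_sqrtr // ltW.
exists (block_mx s%:M 0 (s^-1 *: b) L').
  by rewrite unitmxE det_lblock det_scalar1 unitrM unitfE gt_eqF //= -unitmxE.
rewrite MCE tr_block_mx mulmx_block trmx0 tr_scalar_mx linearZ /=.
rewrite !mulmx0 !mul0mx !addr0 -scalar_mxM ss mul_scalar_mx mul_mx_scalar.
rewrite !scalerA divff ?gt_eqF // !scale1r; congr block_mx.
by rewrite -SE -scalemxAr -scalemxAl scalerA -invfM ss addrC subrK.
Qed.

(** * Quadratic forms and small perturbations of the identity *)

Lemma sqnorm_ge0 (R : realDomainType) (m : nat) (x : 'cV[R]_m) : 0 <= (x^T *m x) 0 0.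
Proof. by rewrite mxE sumr_ge0 // => i _; rewrite mxE -expr2 sqr_ge0. Qed.

Lemma sqr_coord_le_sqnorm (R : realDomainType) (m : nat) (x : 'cV[R]_m) (i : 'I_m) :
  x i 0 ^+ 2 <= (x^T *m x) 0 0.
Proof.
rewrite mxE (bigD1 i) //= mxE -expr2 lerDl sumr_ge0 // => j _.
by rewrite mxE -expr2 sqr_ge0.
Qed.

Lemma sqnorm_gt0 (R : realDomainType) (m : nat) (x : 'cV[R]_m) :
  x != 0 -> 0 < (x^T *m x) 0 0.
Proof.
move=> x_neq0; rewrite lt_def sqnorm_ge0 andbT; apply: contra_neq x_neq0 => x0.
apply/colP => i; rewrite mxE; apply/eqP; rewrite -sqrf_eq0 eq_le sqr_ge0 andbT.
by rewrite -x0 sqr_coord_le_sqnorm.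
Qed.

(** Each product |x_i| |x_j| is at most (x_i^2 + x_j^2) / 2, hence at most the squared norm of
    [x]. *)
Lemma quad_form_bound (R : realFieldType) (m : nat) (Z : 'M[R]_m) (x : 'cV[R]_m) :
  `|(x^T *m Z *m x) 0 0| <= (\sum_i \sum_j `|Z i j|) * (x^T *m x) 0 0.
Proof.
rewrite exchange_big /= mxE mulr_suml (le_trans (ler_norm_sum _ _ _)) //.
apply: ler_sum => j _; rewrite mxE !mulr_suml (le_trans (ler_norm_sum _ _ _)) //.
apply: ler_sum => i _; rewrite mxE !normrM [`|x i 0| * _]mulrC -mulrA.
rewrite ler_wpM2l //.
have := sqr_coord_le_sqnorm x i; have := sqr_coord_le_sqnorm x j.
have := sqr_ge0 (`|x i 0| - `|x j 0|).
by rewrite sqrrB !real_normK ?num_real //; lra.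
Qed.

(** For t > 0 the determinant is t^m times the characteristic polynomial of -Z at 1/t, where m is
    the size of [Z]. The two leading coefficients, 1 and tr Z, give 1 + t tr Z; every other term
    carries a power of t that is at least 2, and such a power is at most t^2 because t <= 1. *)
Lemma det_1DZ_expansion (R : realFieldType) (m : nat) (Z : 'M[R]_m) :
  exists2 C : R, 0 <= C & forall t : R, 0 < t <= 1 ->
    `|\det (1%:M + t *: Z) - (1 + t * \tr Z)| <= C * t ^+ 2.
Proof.
case: m Z => [|m] Z.
  exists 0 => // t _; rewrite det_mx00 /mxtrace big_ord0.
  by rewrite mulr0 addr0 subrr normr0 mul0r.
pose c := char_poly (- Z).
exists (\sum_(i < m) `|c`_i|) => [|t /andP[t_gt0 t_le1]]; first exact: sumr_ge0.
have t_neq0 : t != 0 by rewrite gt_eqF.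
have -> : 1%:M + t *: Z = t *: (t^-1%:M - (- Z)).
  by rewrite opprK scalerDr scale_scalar_mx divff.
have -> : \det (t *: (t^-1%:M - (- Z))) = t ^+ m.+1 * c.[t^-1].
  rewrite detZ; congr (_ * _); rewrite -[RHS]/(horner_eval t^-1 c) -det_map_mx.
  congr (\det _); apply/matrixP => i j.
  by rewrite !mxE rmorphB rmorphMn /= /horner_eval hornerX hornerC.
have cm1 : c`_m.+1 = 1.
  by rewrite -(monicP (char_poly_monic (- Z))) lead_coefE size_char_poly.
have cm : c`_m = \tr Z by rewrite (char_poly_trace (- Z)) // linearN opprK.
rewrite horner_coef size_char_poly !big_ord_recr /= cm1 cm mul1r !mulrDr.
rewrite -exprMn divff // expr1n.
have -> : t ^+ m.+1 * (\tr Z * t^-1 ^+ m) = t * \tr Z.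
  by rewrite mulrCA exprS -mulrA -exprMn divff // expr1n mulr1 mulrC.
rewrite [X in `|X|](_ : _ = t ^+ m.+1 * \sum_(i < m) c`_i * t^-1 ^+ i); last by ring.
rewrite mulr_sumr mulr_suml (le_trans (ler_norm_sum _ _ _)) //.
apply: ler_sum => i _.
rewrite mulrCA normrM ler_wpM2l //.
(* The index satisfies i < m for a matrix of size m + 1, so at least two factors t remain after
   cancelling t^-i. *)
have /subnKC <- : (i + 2 <= m.+1)%N by rewrite addn2 ltnS.
rewrite -addnA exprD mulrAC -exprMn divff // expr1n mul1r exprD.
rewrite normrM !normrX (gtr0_norm t_gt0) ler_piMr //.
  by rewrite exprn_ge0 // ltW.
by rewrite exprn_ile1 // ltW.
Qed.

(** The upper bound ln (1 + y) <= y is applied at y = - x / (1 + x), for which 1 + y is the inverse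
    of 1 + x. *)
Lemma ln1D_ge (R : realType) (x : R) : -1 < x -> x - x ^+ 2 / (1 + x) <= ln (1 + x).
Proof.
move=> x_gtN1; have x1_gt0 : 0 < 1 + x by lra.
have -> : x - x ^+ 2 / (1 + x) = - (- x / (1 + x)) by field; rewrite gt_eqF.
rewrite lerNl -lnV ?posrE //.
rewrite [X in ln X](_ : _ = 1 + (- x / (1 + x))); last by field; rewrite gt_eqF.
apply: le_ln1Dx; rewrite ltr_pdivlMr //; lra.
Qed.

Lemma ln_det_1DZ_ge (R : realType) (m : nat) (Z : 'M[R]_m) :
  exists e C : R, [/\ 0 < e, 0 <= C & forall t : R, 0 < t -> t <= e ->
    0 < \det (1%:M + t *: Z) /\
    t * \tr Z - C * t ^+ 2 <= ln (\det (1%:M + t *: Z))].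
Proof.
have [C C_ge0 detE] := det_1DZ_expansion Z.
set B := `|\tr Z| + C.
have B_ge0 : 0 <= B by rewrite addr_ge0.
(* Write the determinant as 1 + x, with |x| <= t B. This threshold gives t B <= 1/2, hence 1 + x >=
   1/2 and x^2 / (1 + x) <= 2 B^2 t^2. The remaining [C] is the error of the determinant
   expansion. *)
exists (2 * (1 + B))^-1, (C + 2 * B ^+ 2).
split; [by rewrite invr_gt0; lra | by rewrite addr_ge0 // mulr_ge0 // sqr_ge0 |].
move=> t t_gt0; rewrite -[_^-1]mul1r ler_pdivlMr; last by lra.
move=> t_small.
have tB_ge0 : 0 <= t * B by rewrite mulr_ge0 // ltW.
have t_le1 : t <= 1 by lra.
have /detE dx : 0 < t <= 1 by rewrite t_gt0.
pose x := \det (1%:M + t *: Z) - 1.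
have -> : \det (1%:M + t *: Z) = 1 + x by rewrite /x addrCA subrr addr0.
have {}dx : `|x - t * \tr Z| <= C * t ^+ 2.
  by rewrite (_ : x - t * \tr Z = \det (1%:M + t *: Z) - (1 + t * \tr Z)) // /x; ring.
have xB : `|x| <= t * B.
  rewrite -[x](subrK (t * \tr Z)) (le_trans (ler_normD _ _)) // normrM.
  rewrite (gtr0_norm t_gt0) /B mulrDr addrC lerD2l (le_trans dx) // mulrC.
  by rewrite ler_wpM2r // expr2 ler_piMl // ltW.
have x_ge : - 2^-1 <= x by have := ler_norm (- x); rewrite normrN; lra.
split; first by lra.
have x2 : x ^+ 2 / (1 + x) <= 2 * (t * B) ^+ 2.
  rewrite ler_pdivrMr; last by lra.
  have : x ^+ 2 <= (t * B) ^+ 2 by rewrite -real_normK ?num_real // lerXn2r ?nnegrE.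
  have := sqr_ge0 (t * B); nra.
have : x - x ^+ 2 / (1 + x) <= ln (1 + x) by apply: ln1D_ge; lra.
have := ler_norm (- (x - t * \tr Z)); rewrite normrN exprMn in x2 *.
lra.
Qed.

(** With B the sum of the absolute values of the entries of [Z], the form at [x] is at least (1 - t
    B) |x|^2, and t (1 + B) <= 1 forces t B < 1. *)
Lemma posdef_1DZ (R : realType) (m : nat) (Z : 'M[R]_m) : symmx Z ->
  exists2 e : R, 0 < e & forall t : R, 0 < t -> t <= e -> posdef (1%:M + t *: Z).
Proof.
move=> symZ; set B := \sum_i \sum_j `|Z i j|.
have B_ge0 : 0 <= B by do 2![apply: sumr_ge0 => ? _].
exists (1 + B)^-1 => [|t t_gt0]; first by rewrite invr_gt0; lra.
rewrite -[_^-1]mul1r ler_pdivlMr; last by lra.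
move=> t_small; split=> [|x x_neq0].
  by rewrite /symmx linearD linearZ /= trmx1 symZ.
rewrite mulmxDr mulmxDl mulmx1 -scalemxAr -scalemxAl mxE [X in _ + X]mxE.
have := quad_form_bound Z x; rewrite -/B ler_norml => /andP[+ _].
have := sqnorm_gt0 x_neq0.
by set y := (_ *m x) 0 0; set z := (_ *m x) 0 0; nra.
Qed.

Lemma posdef_congr (R : realType) (m : nat) (L A : 'M[R]_m) :
  L \in unitmx -> posdef A -> posdef (L *m A *m L^T).
Proof.
move=> uL [symA posA]; split=> [|x x_neq0].
  by rewrite /symmx !trmx_mul trmxK symA mulmxA.
have -> : x^T *m (L *m A *m L^T) *m x = (L^T *m x)^T *m A *m (L^T *m x).
  by rewrite trmx_mul trmxK !mulmxA.
apply: posA; apply: contra_neq x_neq0 => Lx0.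
by rewrite -[x](mulKmx (_ : L^T \in unitmx)) ?unitmx_tr // Lx0 mulmx0.
Qed.

Lemma exists_expr_le (R : realType) (b e : R) :
  0 < b -> b < 1 -> 0 < e -> exists k : nat, b ^+ k <= e.
Proof.
move=> b_gt0 b_lt1 e_gt0.
have nb_lt1 : `|b| < 1 by rewrite gtr0_norm.
have [k _ /(_ k (leqnn k))] := cvgr0_norm_lt (_ : nat -> R^o) (cvg_expr nb_lt1) _ e_gt0.
by rewrite gtr0_norm ?exprn_gt0 // => /ltW; exists k.
Qed.

(** * Kronecker sums and the off-diagonal norm *)

Lemma kronsumE (R : pzRingType) (p q : nat) (A : 'M[R]_p) (B : 'M[R]_q)
    (a b : 'I_p) (i j : 'I_q) :
  kronsum A B (mxtens_index (a, i)) (mxtens_index (b, j))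
    = A a b *+ (i == j) + B i j *+ (a == b).
Proof. by rewrite mxE !tensmxE !mxE mulr_natr mulr_natl. Qed.

Lemma kronsumD (R : pzRingType) (p q : nat) (A A' : 'M[R]_p) (B B' : 'M[R]_q) :
  kronsum (A + A') (B + B') = kronsum A B + kronsum A' B'.
Proof.
apply/matrixP => k l; rewrite [RHS]mxE.
case: (mxtens_indexP k) => a i; case: (mxtens_indexP l) => b j {k l}.
by rewrite !kronsumE !mxE !mulrnDl addrACA.
Qed.

Lemma kronsumZ (R : pzRingType) (p q : nat) (c : R) (A : 'M[R]_p) (B : 'M[R]_q) :
  kronsum (c *: A) (c *: B) = c *: kronsum A B.
Proof.
apply/matrixP => k l; rewrite [RHS]mxE.
case: (mxtens_indexP k) => a i; case: (mxtens_indexP l) => b j {k l}.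
by rewrite !kronsumE !mxE mulrDr !mulrnAr.
Qed.

Lemma kronsum_tr (R : pzRingType) (p q : nat) (A : 'M[R]_p) (B : 'M[R]_q) :
  (kronsum A B)^T = kronsum A^T B^T.
Proof. by rewrite /kronsum linearD /= !trmx_tens !trmx1. Qed.

Lemma kronsum_shift (R : pzRingType) (p q : nat) (c : R) (A : 'M[R]_p) (B : 'M[R]_q) :
  kronsum (A - c%:M) (B + c%:M) = kronsum A B.
Proof.
apply/matrixP => k l.
case: (mxtens_indexP k) => a i; case: (mxtens_indexP l) => b j {k l}.
rewrite !kronsumE !mxE; case: (a == b); case: (i == j);
  rewrite ?mulr1n ?mulr0n ?subr0 ?addr0 //.
by rewrite addrACA addNr addr0.
Qed.

(** The kernel of the Kronecker sum consists of the shifts alone, so a direction with vanishing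
    Kronecker sum is equivalent to zero. Positive dimensions supply the base indices at which the
    diagonals of [A] and [B] are compared. *)
Lemma kronsum_eq0 (R : pzRingType) (p q : nat) (A : 'M[R]_p) (B : 'M[R]_q) :
  (0 < p)%N -> (0 < q)%N -> kronsum A B = 0 ->
  exists c : R, A = c%:M /\ B = (- c)%:M.
Proof.
move=> p_gt0 q_gt0 AB0; pose a0 := Ordinal p_gt0; pose i0 := Ordinal q_gt0.
have E a b i j : A a b *+ (i == j) + B i j *+ (a == b) = 0.
  by rewrite -kronsumE AB0 mxE.
have diagB i : B i i = - A a0 a0.
  by have /eqP := E a0 a0 i i; rewrite !eqxx !mulr1n addrC addr_eq0 => /eqP.
exists (A a0 a0); split; apply/matrixP.
  move=> a b; rewrite mxE; have := E a b i0 i0; rewrite eqxx mulr1n diagB.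
  by case: (a == b); rewrite ?mulr1n ?mulr0n ?addr0 // => /eqP; rewrite subr_eq0 => /eqP.
move=> i j; rewrite mxE; have := E a0 a0 i j; rewrite eqxx mulr1n addrC.
case: (i == j); rewrite ?mulr1n ?mulr0n ?addr0 // => /eqP.
by rewrite addr_eq0 => /eqP.
Qed.

Lemma norm1off_shift (R : realType) (m : nat) (c : R) (A : 'M[R]_m) :
  norm1off (A + c%:M) = norm1off A.
Proof.
apply: eq_bigr => i _; apply: eq_bigr => j /negPf neq_ij.
by rewrite !mxE neq_ij mulr0n addr0.
Qed.

Lemma norm1off_convex (R : realType) (m : nat) (A D : 'M[R]_m) (t : R) :
  0 <= t -> t <= 1 ->
  norm1off (A + t *: D) <= (1 - t) * norm1off A + t * norm1off (A + D).
Proof.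
move=> t_ge0 t_le1; rewrite /norm1off !mulr_sumr -big_split; apply: ler_sum => i _.
rewrite !mulr_sumr -big_split; apply: ler_sum => j _ /=; rewrite !mxE.
have -> : A i j + t * D i j = (1 - t) * A i j + t * (A i j + D i j) by ring.
rewrite (le_trans (ler_normD _ _)) // !normrM (ger0_norm t_ge0) ger0_norm //.
by rewrite subr_ge0.
Qed.

(** * Shift invariance of the tests and termination of the search *)

Section LineSearch.
Context (R : realType) (p q n : nat) (Y : 'I_n -> 'M[R]_(q, p)) (gT gP : R).
Hypotheses (p_gt0 : (0 < p)%N) (q_gt0 : (0 < q)%N).

(** After normalisation both sides are 1/n times a sum of traces, and the traces agree term by term
    by cyclicity. *)
Lemma trace_covST : q%:R * \tr (covS Y) = p%:R * \tr (covT Y).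
Proof.
have cancel m : (0 < m)%N -> m%:R * (n * m)%:R^-1 = n%:R^-1 :> R.
  by move=> m_gt0; rewrite natrM invfM mulrCA divff ?mulr1 // pnatr_eq0 -lt0n.
rewrite !mxtraceZ !mulrA !cancel //; congr (_ * _).
by rewrite !linear_sum; apply: eq_bigr => i _; rewrite /= mxtrace_mulC.
Qed.

Lemma linear_part_shift (c : R) (A : 'M[R]_p) (B : 'M[R]_q) :
  q%:R * \tr (covS Y *m (A - c%:M)) + p%:R * \tr (covT Y *m (B + c%:M))
    = q%:R * \tr (covS Y *m A) + p%:R * \tr (covT Y *m B).
Proof.
rewrite mulmxBr mulmxDr !mul_mx_scalar linearB mxtraceD /= !(mxtraceZ c).
rewrite mulrBr mulrDr ![_ * (c * _)]mulrCA trace_covST; ring.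
Qed.

Lemma objg_shift (c : R) (A : 'M[R]_p) (B : 'M[R]_q) :
  objg Y (A - c%:M) (B + c%:M) = objg Y A B.
Proof. by rewrite /objg kronsum_shift linear_part_shift. Qed.

Lemma objh_shift (c : R) (A : 'M[R]_p) (B : 'M[R]_q) :
  objh gT gP (A - c%:M) (B + c%:M) = objh gT gP A B.
Proof. by rewrite /objh -raddfN !norm1off_shift. Qed.

(** Cyclicity of the trace moves the embeddings from W onto [A^T] and [B^T], where they sum to a
    Kronecker sum. Shift invariance can then be read off the right-hand side. *)
Lemma vecG_pairing (Theta A : 'M[R]_p) (Psi B : 'M[R]_q) :
  ((vec2 A B)^T *m vecG Y Theta Psi) 0 0
    = q%:R * \tr (covS Y *m A^T) + p%:R * \tr (covT Y *m B^T)
      - \tr (kronsum A^T B^T *m covW Theta Psi).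
Proof.
rewrite /vecG /vec2 tr_col_mx mul_row_col mxE !vec_trace.
rewrite /gradTheta /gradPsi; move: (covS Y) (covT Y) => S T.
rewrite !mulmxBr !linearB -!scalemxAr !linearZ /=.
rewrite (mxtrace_mulC A^T) (mxtrace_mulC B^T).
rewrite /kronsum -IkronE_sum -EkronI_sum mulmxDl linearD /= opprD addrACA.
congr (_ + (- _ - _)); rewrite mulmx_sumr mulmx_suml !linear_sum /=.
  apply: eq_bigr => i _.
  by rewrite -!mulmxA [RHS]mxtrace_mulC !mulmxA.
apply: eq_bigr => i _.
by rewrite -!mulmxA [RHS]mxtrace_mulC !mulmxA.
Qed.

(** P sends the direction to the vectorisation of its Kronecker sum K, and the Kronecker square of W
    sends that to the vectorisation of W K W^T. *)
Lemma hessian_form (Theta A : 'M[R]_p) (Psi B : 'M[R]_q) :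
  ((vec2 A B)^T *m hessian Theta Psi *m vec2 A B) 0 0
    = \tr ((kronsum A B)^T
           *m (covW Theta Psi *m kronsum A B *m (covW Theta Psi)^T)).
Proof.
rewrite /hessian !mulmxA -trmx_mul -[_ *m matP *m _]mulmxA matP_vec2.
by rewrite -mulmxA vec_tens vec_trace !mulmxA.
Qed.

Lemma decrement_shift (c : R) (Theta A : 'M[R]_p) (Psi B : 'M[R]_q) :
  decrement Y gT gP Theta Psi (A - c%:M) (B + c%:M)
    = decrement Y gT gP Theta Psi A B.
Proof.
rewrite /decrement (addrA Theta) (addrA Psi) objh_shift !vecG_pairing.
have -> : (A - c%:M)^T = A^T - c%:M by rewrite linearB /= tr_scalar_mx.
have -> : (B + c%:M)^T = B^T + c%:M by rewrite linearD /= tr_scalar_mx.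
by rewrite linear_part_shift kronsum_shift.
Qed.

(** Stated as an equality of propositions, so that it serves as a rewrite rule. *)
Lemma step_ok_shift (sigma c t : R) (Theta A : 'M[R]_p) (Psi B : 'M[R]_q) :
  step_ok Y gT gP sigma Theta Psi (A - c%:M) (B + c%:M) t
    = step_ok Y gT gP sigma Theta Psi A B t.
Proof.
rewrite /step_ok decrement_shift scalerBr scalerDr !scale_scalar_mx (addrA Theta) (addrA Psi).
by rewrite kronsum_shift /objf objg_shift objh_shift.
Qed.

Lemma step_ok0 (sigma t : R) (Theta : 'M[R]_p) (Psi : 'M[R]_q) :
  posdef (kronsum Theta Psi) -> step_ok Y gT gP sigma Theta Psi 0 0 t.
Proof.
move=> posM; rewrite /step_ok /decrement vecG_pairing !scaler0 !addr0 addrK.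
split=> //; rewrite !trmx0 !mulmx0 /kronsum tens0mx tensmx0 addr0 mul0mx.
by rewrite !linear0 !mulr0 !addr0 mulr0 addr0.
Qed.

Lemma decrement_le (Theta DT : 'M[R]_p) (Psi DP : 'M[R]_q) :
  newton_direction Y gT gP Theta Psi DT DP ->
  decrement Y gT gP Theta Psi DT DP
    <= - (2^-1 * ((vec2 DT DP)^T *m hessian Theta Psi *m vec2 DT DP) 0 0).
Proof.
case=> _ _ /(_ 0 0 (trmx0 _ _ _) (trmx0 _ _ _)).
rewrite /newton_model /ghat /decrement !addr0.
have -> : vec2 0 0 = 0 :> 'cV[R]_(p * p + q * q).
  by rewrite /vec2 /vec !linear0 col_mx0.
have zero00 : (0 : 'M[R]_1) 0 0 = 0 by rewrite mxE.
rewrite !mulmx0 zero00 mulr0 addr0 add0r.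
have -> : ((vecG Y Theta Psi)^T *m vec2 DT DP) 0 0
    = ((vec2 DT DP)^T *m vecG Y Theta Psi) 0 0.
  by rewrite -trace_mx11 -mxtrace_tr trmx_mul trmxK trace_mx11.
by lra.
Qed.

Lemma objh_convex (Theta DT : 'M[R]_p) (Psi DP : 'M[R]_q) (t : R) :
  0 <= gT -> 0 <= gP -> 0 <= t -> t <= 1 ->
  objh gT gP (Theta + t *: DT) (Psi + t *: DP)
    <= (1 - t) * objh gT gP Theta Psi + t * objh gT gP (Theta + DT) (Psi + DP).
Proof.
move=> gT_ge0 gP_ge0 t_ge0 t_le1; rewrite /objh.
have cT : 0 <= q%:R * gT by rewrite mulr_ge0.
have cP : 0 <= p%:R * gP by rewrite mulr_ge0.
have := ler_wpM2l cT (norm1off_convex Theta DT t_ge0 t_le1).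
have := ler_wpM2l cP (norm1off_convex Psi DP t_ge0 t_le1).
lra.
Qed.

Lemma exists_step_ok (sigma beta : R) (Theta DT : 'M[R]_p) (Psi DP : 'M[R]_q) :
  0 <= gT -> 0 <= gP -> sigma < 1 -> 0 < beta -> beta < 1 ->
  posdef (kronsum Theta Psi) -> newton_direction Y gT gP Theta Psi DT DP ->
  exists k, step_ok Y gT gP sigma Theta Psi DT DP (beta ^+ k).
Proof.
move=> gT_ge0 gP_ge0 sigma_lt1 beta_gt0 beta_lt1 posM newtonD.
have [symDT symDP _] := newtonD.
set M := kronsum Theta Psi in posM; pose K := kronsum DT DP.
have symK : K^T = K by rewrite /K kronsum_tr symDT symDP.
have [L uL ME] := posdef_cholesky posM.
pose N := invmx L; pose Z := N *m K *m N^T.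
have WE : covW Theta Psi = N^T *m N.
  have MW : L *m L^T *m (N^T *m N) = 1%:M.
    by rewrite mulmxA -(mulmxA L) -trmx_mul mulVmx // trmx1 mulmx1 mulmxV.
  have uM : L *m L^T \in unitmx by rewrite unitmx_mul unitmx_tr uL.
  by rewrite /covW -/M ME -[RHS](mulKmx uM) MW mulmx1.
have symZ : symmx Z by rewrite /symmx /Z !trmx_mul trmxK symK mulmxA.
have KE : K = L *m Z *m L^T.
  rewrite /Z !mulmxA mulmxV // mul1mx -mulmxA -trmx_mul mulmxV // trmx1.
  by rewrite mulmx1.
have quadE : ((vec2 DT DP)^T *m hessian Theta Psi *m vec2 DT DP) 0 0
    = \tr (Z^T *m Z).
  rewrite hessian_form -/K WE symZ /Z trmx_mul trmxK symK.
  by rewrite !mulmxA [LHS]mxtrace_mulC !mulmxA.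
have := decrement_le newtonD; rewrite quadE -vec_trace.
have [Z0 _|Z_neq0 delta_lt0] := eqVneq Z 0.
  have [c [-> ->]] : exists c, DT = c%:M /\ DP = (- c)%:M.
    by apply: kronsum_eq0 => //; rewrite -/K KE Z0 mulmx0 mul0mx.
  (* Shifting the direction (c I, - c I) by [c] gives the zero direction, whose decrement is 0 and
     which leaves the objective unchanged. *)
  exists 0%N; rewrite -[step_ok _ _ _ _ _ _ _ _ _](step_ok_shift _ c).
  by rewrite subrr raddfN addNr; apply: step_ok0.
have {}delta_lt0 : decrement Y gT gP Theta Psi DT DP < 0.
  have vecZ_neq0 : vec Z != 0.
    apply: contra_neq Z_neq0 => vecZ0; apply/matrixP => i j.
    by rewrite -vecE vecZ0 !mxE.
  by have := sqnorm_gt0 vecZ_neq0; lra.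
have [e1 e1_gt0 posZ] := posdef_1DZ symZ.
have [e2 [C [e2_gt0 C_ge0 lnZ]]] := ln_det_1DZ_ge Z.
set delta := decrement _ _ _ _ _ _ _ in delta_lt0.
(* The objective changes by at most t delta + C t^2, which is below t sigma delta once C t <= (1 -
   sigma) (- delta). Dividing by C + 1 covers the case C = 0. *)
pose e3 := (1 - sigma) * - delta / (C + 1).
have e3_gt0 : 0 < e3.
  by rewrite divr_gt0 ?mulr_gt0 //; lra.
have [k] : exists k, beta ^+ k <= Num.min e1 (Num.min e2 e3).
  by apply: exists_expr_le; rewrite // !lt_min e1_gt0 e2_gt0.
have : beta ^+ k <= 1 by rewrite exprn_ile1 // ltW.
have : 0 < beta ^+ k by rewrite exprn_gt0.
set t := beta ^+ k => t_gt0 t_le1.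
rewrite !le_min => /and3P[t_e1 t_e2 t_e3]; exists k; rewrite -/t.
have kronE : kronsum (Theta + t *: DT) (Psi + t *: DP)
    = L *m (1%:M + t *: Z) *m L^T.
  rewrite kronsumD kronsumZ -/M -/K ME mulmxDr mulmx1 mulmxDl; congr (_ + _).
  by rewrite KE -scalemxAr -scalemxAl.
split; first by rewrite kronE; apply/posdef_congr/posZ.
have [detZ_gt0 {}lnZ] := lnZ t t_gt0 t_e2.
have lnE : ln (\det (kronsum (Theta + t *: DT) (Psi + t *: DP)))
    = ln (\det M) + ln (\det (1%:M + t *: Z)).
  have detL_neq0 : \det L != 0 by rewrite -unitfE -unitmxE.
  have detM : \det M = \det L ^+ 2 by rewrite ME det_mulmx det_tr expr2.
  rewrite kronE !det_mulmx det_tr mulrAC -expr2 -detM lnM ?posrE //.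
  by rewrite detM exprn_even_gt0.
(* Since W = N^T N, the trace of K W is tr Z, which is also the first-order coefficient of the
   log-determinant along the direction. *)
have deltaE : delta = q%:R * \tr (covS Y *m DT) + p%:R * \tr (covT Y *m DP)
    - \tr Z + objh gT gP (Theta + DT) (Psi + DP) - objh gT gP Theta Psi.
  rewrite /delta /decrement vecG_pairing symDT symDP -/K WE.
  by rewrite [K *m _]mulmxA [\tr (_ *m N)]mxtrace_mulC [N *m _]mulmxA.
have trDZ m (X A D : 'M[R]_m) :
    \tr (X *m (A + t *: D)) = \tr (X *m A) + t * \tr (X *m D).
  by rewrite mulmxDr -scalemxAr mxtraceD mxtraceZ.
have Ct2_le : t * (C * t) <= t * ((1 - sigma) * - delta).
  rewrite ler_pM2l //; move: t_e3; rewrite ler_pdivlMr; last by lra.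
  by rewrite mulrDr mulr1; lra.
have h_le := objh_convex Theta DT Psi DP gT_ge0 gP_ge0 (ltW t_gt0) t_le1.
rewrite /objf /objg -/M lnE !trDZ -/delta.
(* The trace terms are affine in t, the log-determinant costs at most C t^2 beyond first order, and
   h lies below its chord. Multiplying the formula for [delta] by t makes the combination of these
   bounds linear in the products that occur. *)
have := congr1 ( *%R t) deltaE.
lra.
Qed.

End LineSearch.

Theorem lemma7 (R : realType) (p q n : nat)
    (hp : (1 <= p)%N) (hq : (1 <= q)%N) (hn : (1 <= n)%N)
    (Y : 'I_n -> 'M[R]_(q, p)) (gT gP : R) (hgT : 0 <= gT) (hgP : 0 <= gP)
    (sigma beta : R)
    (hsigma0 : 0 < sigma) (hsigma1 : sigma < 1 / 2)
    (hbeta0 : 0 < beta) (hbeta1 : beta < 1)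
    (Theta : 'M[R]_p) (Psi : 'M[R]_q)
    (hTheta : symmx Theta) (hPsi : symmx Psi)
    (hpos : posdef (kronsum Theta Psi))
    (DT : 'M[R]_p) (DP : 'M[R]_q)
    (hD : newton_direction Y gT gP Theta Psi DT DP) :
  exists alpha : R, forall (c alpha' : R),
    line_search Y gT gP sigma beta Theta Psi (DT - c%:M) (DP + c%:M) alpha'
    <-> alpha' = alpha.
Proof.
pose ok k := step_ok Y gT gP sigma Theta Psi DT DP (beta ^+ k).
have exok : exists k, `[< ok k >].
  have sigma_lt1 : sigma < 1 by lra.
  have [k okk] := exists_step_ok hp hq hgT hgP sigma_lt1 hbeta0 hbeta1 hpos hD.
  by exists k; apply/asboolP.
(* The least accepted exponent for the unshifted direction is the witness; the tests being shift
   invariant, it serves every [c]. *)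
have [k /asboolP okk mink] := ex_minnP exok.
exists (beta ^+ k) => c alpha'; split=> [[l []]|->].
  rewrite step_ok_shift // => -> okl minl; congr (_ ^+ _).
  (* Both exponents are least among the accepted ones, so each bounds the other. *)
  apply/eqP; rewrite eqn_leq mink ?andbT; last exact/asboolP.
  rewrite leqNgt; apply/negP => /minl; rewrite step_ok_shift //; exact.
exists k; split=> [//||j ltjk]; rewrite step_ok_shift // => okj.
by have := mink j (asboolT okj); rewrite leqNgt ltjk.
Qed.
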